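(* For every $n\ge1$, the real-input algorithm $\mathsf R_n$ for the alternating product $\times_n$ (described in the context) uses at most $$C_n=(9n-21)2^{n-1}+12$$ real bilinear multiplications. Consequently, with $N=2^n$, the real tensor rank of the multiplication tensor $T_{A_n}$ of $A_n$ satisfies $$\operatorname{R}_{\mathbb R}(T_{A_n})\le(9n-15)2^{n-1}+10=O(N\log N).$$
   Context: **Cayley--Dickson tower.** $A_0:=\mathbb R$ with $\bar r=r$. Recursively $A_n:=A_{n-1}\oplus A_{n-1}$ with $$\overline{(a,b)}=(\bar a,-b),\qquad (a,b)(c,d)=\bigl(ac-\bar d\,b,\;da+b\bar c\bigr).$$ The standard (recursive, concatenated) basis identifies $A_n$ with $\mathbb R^{2^n}$ and gives its Euclidean inner product $\langle\cdot,\cdot\rangle$. Scalars are identified with multiples of the unit. Put $V_n:=\{x\in A_n:\bar x=-x\}$, and for $u,v\in V_n$ define $u\times_n v:=\frac12(uv-vu)\in V_n$. **The real-input algorithm.** Let $V_n^{\mathbb C}=V_n\otimes_{\mathbb R}\mathbb C$, $\mathbb C=\mathbb R(\iota)$, $\iota^2=-1$, with the involution extended $\mathbb C$-linearly and $\langle z,w\rangle_{\mathrm{bil}}=\sum_j z_jw_j$ (no conjugation). For $n\ge2$ every element of $V_n^{\mathbb C}$ (resp. $V_n$) is uniquely $(u,\gamma+s)$ with $u,s\in V_{n-1}^{\mathbb C}$, $\gamma\in\mathbb C$ (resp. $u,s\in V_{n-1}$, $\gamma\in\mathbb R$). $\operatorname{Re}_{\mathrm c},\operatorname{Im}_{\mathrm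 c}$ denote coefficientwise real and imaginary parts. - $\mathsf C_n(X,Y)$ for $n\ge 1$, $X,Y\in V_n^{\mathbb C}$: if $n=1$ return $0$. Otherwise write $X=(u,\gamma+s)$, $Y=(v,\delta+t)$; set $Z_\pm\leftarrow\mathsf C_{n-1}(u\pm\iota s,v\pm\iota t)$, $\lambda\leftarrow\langle s,v\rangle_{\mathrm{bil}}-\langle t,u\rangle_{\mathrm{bil}}$, $F\leftarrow (Z_++Z_-)/2+\gamma t-\delta s$, $G\leftarrow\lambda+\delta u-\gamma v+\iota(Z_+-Z_-)/2$; return $(F,G)$. - $\mathsf R_n(X,Y)$ for $n\ge 1$, $X,Y\in V_n$: if $n=1$ return $0$. Otherwise write $X=(u,\gamma+s)$, $Y=(v,\delta+t)$; set $Z\leftarrow\mathsf C_{n-1}(u+\iota s,v+\iota t)$, $\lambda\leftarrow\langle s,v\rangle-\langle t,u\rangle$, $F\leftarrow\operatorname{Re}_{\mathrm c}Z+\gamma t-\delta s$, $G\leftarrow\lambda+\delta u-\gamma v-\operatorname{Im}_{\mathrm c}Z$; return $(F,G)$. Each complex scalar product is evaluated with three real products: $(a+\iota b)(c+\iota d)=(p-q)+\iota(r-p-q)$ with $p=ac$, $q=bd$, $r=(a+b)(c+d)$. **Counting.** A real bilinear multiplication is a product of a real linear form in the first input by a real linear form in the second input. Linear operations, including multiplications by fixed constants such as $1/2$, are not counted. For a bilinear map $\mu:U_1\times U_2\to W$ of finite-dimensional real vector spaces, its real tensor rank is the least integer $r$ for which $\mu(x,y)=\sum_{j=1}^r\alpha_j(x)\beta_j(y)w_j$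 with $\alpha_j\in U_1^*$, $\beta_j\in U_2^*$, $w_j\in W$. $T_{A_n}$ is the tensor of the multiplication map $A_n\times A_n\to A_n$ and $\operatorname{R}_{\mathbb R}(T_{A_n})$ its real tensor rank. Logarithms are to base two. *)

(* Defs.v *)
From HB Require Import structures.
From mathcomp Require Import all_boot all_order all_algebra.
From mathcomp Require Import all_classical all_reals all_analysis.

Set Implicit Arguments.
Unset Strict Implicit.
Unset Printing Implicit Defensive.

Import Order.TTheory GRing.Theory Num.Theory.
Import numFieldNormedType.Exports.
Local Open Scope classical_set_scope.
Local Open Scope ring_scope.

Section Coordinates.
Variable R : realType.

(* [CD S n] consists of the families of 2^n coordinates taken in the real vector
   space S, arranged by the recursive, concatenated basis.  The real algebra A_n
   is [CD R^o n].  Inputs of an algorithm are instead given coordinates in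
   abstract spaces S, see [Algorithms] below. *)
Fixpoint CD (S : vectType R) (n : nat) : vectType R :=
  if n is m.+1 then (CD S m * CD S m)%type : vectType R else S.

Fixpoint cd_map (S T : vectType R) (f : S -> T) n : CD S n -> CD T n :=
  if n is m.+1 then fun x => (cd_map f x.1, cd_map f x.2) else f.

Fixpoint cd_scalar (S : vectType R) n (g : S) : CD S n :=
  if n is m.+1 then (cd_scalar m g, 0) else g.

Fixpoint cd_re (S : vectType R) n : CD S n -> S :=
  if n is m.+1 then fun x => cd_re x.1 else id.

Definition cd_im (S : vectType R) n (x : CD S n) : CD S n :=
  x - cd_scalar n (cd_re x).

(* The complexification of S is S * S: the pair (a, b) stands for a + iota b. *)
Definition cplx (S : vectType R) : vectType R := (S * S)%type.
Definition cplx_of (S : vectType R) (a : S) : cplx S := (a, 0).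
Definition cplx_Re (S : vectType R) (z : cplx S) : S := z.1.
Definition cplx_Im (S : vectType R) (z : cplx S) : S := z.2.
Definition cplx_iota (S : vectType R) (z : cplx S) : cplx S := (- z.2, z.1).

End Coordinates.

Notation CDalg R n := (CD (R^o : vectType R) n).

Section CayleyDickson.
Variable R : realType.

Fixpoint cd_conj n : CDalg R n -> CDalg R n :=
  if n is m.+1 then fun x => (cd_conj x.1, - x.2) else id.

Fixpoint cd_mul n : CDalg R n -> CDalg R n -> CDalg R n :=
  if n is m.+1 then fun x y =>
    (cd_mul x.1 y.1 - cd_mul (cd_conj y.2) x.2,
     cd_mul y.2 x.1 + cd_mul x.2 (cd_conj y.1))
  else fun x y => (x : R) * (y : R).

Definition imaginary n : set (CDalg R n) := [set x | cd_conj x = - x].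

Definition cross n (u v : CDalg R n) : CDalg R n :=
  2^-1 *: (cd_mul u v - cd_mul v u).

End CayleyDickson.

(* The algorithms are written over three abstract real vector spaces: L1 for
   linear forms in the first input, L2 for linear forms in the second input, and
   W for results.  Typing then only allows linear operations, except for
   [real_mul], the product L1 x L2 -> W.  Every use of [real_mul] is recorded
   with its two factors, so the number of real bilinear multiplications
   performed is the length of the record.  Actual execution on real inputs is
   the instance L1 = L2 = W = R (see [R_run]). *)
Section Algorithms.
Variables (R : realType) (L1 L2 W : vectType R) (mul : L1 -> L2 -> W).

Definition recorded (T : Type) : Type := (T * seq (L1 * L2))%type.

Definition ret T (x : T) : recorded T := (x, [::]).

Definition bind T U (m : recorded T) (k : T -> recorded U) : recorded U :=
  ((k m.1).1, m.2 ++ (k m.1).2).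

Local Notation "'let*' x ':=' m 'in' k" := (bind m (fun x => k))
  (at level 200, x name, m at level 200, k at level 200).

Definition real_mul (a : L1) (b : L2) : recorded W := (mul a b, [:: (a, b)]).

Definition cplx_mul (z : cplx L1) (w : cplx L2) : recorded (cplx W) :=
  let* p := real_mul z.1 w.1 in
  let* q := real_mul z.2 w.2 in
  let* r := real_mul (z.1 + z.2) (w.1 + w.2) in
  ret (p - q, r - p - q).

Fixpoint mapM (S T : vectType R) (f : S -> recorded T) n :
    CD S n -> recorded (CD T n) :=
  if n is m.+1 then fun x =>
    let* a := mapM f x.1 in let* b := mapM f x.2 in ret (a, b)
  else f.

(* An imaginary x has 2^n - 1 coordinates: the leading entry of its coordinate
   family is zero and takes part in no multiplication. *)
Fixpoint mapM_im (S T : vectType R) (f : S -> recorded T) n :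
    CD S n -> recorded (CD T n) :=
  if n is m.+1 then fun x =>
    let* a := mapM_im f x.1 in let* b := mapM f x.2 in ret (a, b)
  else fun _ => ret 0.

Section InnerProduct.
Variables (S1 S2 S3 : vectType R) (smul : S1 -> S2 -> recorded S3).

Fixpoint dot n : CD S1 n -> CD S2 n -> recorded S3 :=
  if n is m.+1 then fun x y =>
    let* p := dot x.1 y.1 in let* q := dot x.2 y.2 in ret (p + q)
  else smul.

Fixpoint dot_im n : CD S1 n -> CD S2 n -> recorded S3 :=
  if n is m.+1 then fun x y =>
    let* p := dot_im x.1 y.1 in let* q := dot x.2 y.2 in ret (p + q)
  else fun _ _ => ret 0.

End InnerProduct.

(* The value at n = 0, where the only imaginary element is 0, is irrelevant. *)
Fixpoint C_alg n :
    CD (cplx L1) n -> CD (cplx L2) n -> recorded (CD (cplx W) n) :=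
  if n is m.+1 then fun X Y =>
    if m is 0 then ret 0 else
    let iota S := cd_map (@cplx_iota R S) (n := m) in
    let u := X.1 in let gamma := cd_re X.2 in let s := cd_im X.2 in
    let v := Y.1 in let delta := cd_re Y.2 in let t := cd_im Y.2 in
    let* Zp := C_alg (u + iota L1 s) (v + iota L2 t) in
    let* Zm := C_alg (u - iota L1 s) (v - iota L2 t) in
    let* sv := dot_im cplx_mul s v in
    let* ut := dot_im cplx_mul u t in
    let* gamma_t := mapM_im (fun b => cplx_mul gamma b) t in
    let* s_delta := mapM_im (fun a => cplx_mul a delta) s in
    let* u_delta := mapM_im (fun a => cplx_mul a delta) u in
    let* gamma_v := mapM_im (fun b => cplx_mul gamma b) v in
    let lambda := sv - ut in
    let F := 2^-1 *: (Zp + Zm) + gamma_t - s_delta in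
    let G := cd_scalar m lambda + u_delta - gamma_v
             + 2^-1 *: iota W (Zp - Zm) in
    ret (F, G)
  else fun _ _ => ret 0.

Definition R_alg n : CD L1 n -> CD L2 n -> recorded (CD W n) :=
  if n is m.+1 then fun X Y =>
    if m is 0 then ret 0 else
    let plus_iota S (x y : CD S m) : CD (cplx S) m :=
      cd_map (@cplx_of R S) x
      + cd_map (@cplx_iota R S) (cd_map (@cplx_of R S) y) in
    let u := X.1 in let gamma := cd_re X.2 in let s := cd_im X.2 in
    let v := Y.1 in let delta := cd_re Y.2 in let t := cd_im Y.2 in
    let* Z := C_alg (plus_iota L1 u s) (plus_iota L2 v t) in
    let* sv := dot_im real_mul s v in
    let* ut := dot_im real_mul u t in
    let* gamma_t := mapM_im (fun b => real_mul gamma b) t in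
    let* s_delta := mapM_im (fun a => real_mul a delta) s in
    let* u_delta := mapM_im (fun a => real_mul a delta) u in
    let* gamma_v := mapM_im (fun b => real_mul gamma b) v in
    let lambda := sv - ut in
    let F := cd_map (@cplx_Re R W) Z + gamma_t - s_delta in
    let G := cd_scalar m lambda + u_delta - gamma_v
             - cd_map (@cplx_Im R W) Z in
    ret (F, G)
  else fun _ _ => ret 0.

End Algorithms.

Definition R_run (R : realType) n (X Y : CDalg R n) :
    recorded (R^o : vectType R) (R^o : vectType R) (CDalg R n) :=
  R_alg (fun a b : R^o => (a : R) * (b : R) : R^o) X Y.

Definition R_output (R : realType) n (X Y : CDalg R n) : CDalg R n :=
  (R_run X Y).1.

Definition R_products (R : realType) n (X Y : CDalg R n) : seq (R * R) :=
  (R_run X Y).2.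

Section TensorRank.
Variables (R : realType) (U1 U2 W : vectType R) (mu : U1 -> U2 -> W).

Definition rank_decomposition (r : nat) : Prop :=
  exists (alpha : 'I_r -> {scalar U1}) (beta : 'I_r -> {scalar U2})
         (w : 'I_r -> W),
    forall x y, mu x y = \sum_(j < r) (alpha j x * beta j y) *: w j.

Definition is_tensor_rank (r : nat) : Prop :=
  rank_decomposition r /\ forall r', rank_decomposition r' -> (r <= r')%N.

End TensorRank.

Definition log2 (R : realType) (x : R) : R := ln x / ln 2.

(* Main.v *)
Require Import Defs.
From HB Require Import structures.
From mathcomp Require Import all_boot all_order all_algebra.
From mathcomp Require Import all_classical all_reals all_analysis.
From mathcomp Require Import ring lra zify.

Set Implicit Arguments.
Unset Strict Implicit.
Unset Printing Implicit Defensive.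

Import Order.TTheory GRing.Theory Num.Theory.
Import numFieldNormedType.Exports.
Local Open Scope classical_set_scope.
Local Open Scope ring_scope.

(** Write imaginary elements of A_(m+1) as (u, gamma + s) and (v, delta + t)
    with u, s, v, t imaginary in A_m.  For imaginary factors the product splits
    as x y = x × y - <x, y> (polarize x conj(x) = |x|^2), and the doubling
    formula then gives the recursion [cross_double]:
      first half  : u × v - s × t + gamma t - delta s,
      second half : <s, v> - <t, u> + delta u - gamma v - (u × t + s × v).
    The four smaller cross products are needed only in the combinations
    u × v - s × t and u × t + s × v, which are the real and imaginary parts of
    the single complex cross product (u + iota s) × (v + iota t).  So one
    complex product suffices for real inputs.  For complex inputs the two
    combinations are complex vectors, and they are the half sum and half
    difference of the two products (u ± iota s) × (v ± iota t).  Hence the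
    algorithms compute the cross product ([C_algP], [R_algP]).

    For the count, every program met here evaluates a fixed list of products of
    linear forms and combines the results linearly ([bilinear_program]).  This
    class is stable under linear changes of the inputs, linear
    post-processing and juxtaposition, and the numbers of products add up.  The
    six auxiliary vector operations of a step at level m + 1 cost 6 (2^m - 1)
    scalar products, each of which is three real products in the complex case:
      c_(m+1) = 2 c_m + 18 (2^m - 1),     C_(m+1) = c_m + 6 (2^m - 1),
    whence c_n = (9n - 18) 2^n + 18 and C_n = (9n - 21) 2^(n-1) + 12.

    A list of products with linear post-processing is also a tensor
    decomposition.  Since x y = <x, conj(y)> + re(x) im(y) + re(y) im(x)
    + im(x) × im(y) ([cd_mul_split]), the full product costs
    2^n + 2 (2^n - 1) products more than the cross product, which gives the
    bound on the rank. *)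

Section CrossProductAlgorithm.
Variable R : realType.
Implicit Types (S T : vectType R) (n m : nat).

Local Notation Ro := (R^o : vectType R).
Local Notation CRe := (cd_map (@cplx_Re R Ro)).
Local Notation CIm := (cd_map (@cplx_Im R Ro)).
Local Notation iota S := (cd_map (@cplx_iota R S)).
Local Notation of_real S := (cd_map (@cplx_of R S)).

(** * Linearity of the coordinatewise operations *)

Fact cd_re_is_linear S n : linear (@cd_re R S n).
Proof. by elim: n => [|n IH] a x y //=; apply: IH. Qed.
HB.instance Definition _ S n :=
  GRing.isLinear.Build R (CD S n) S *:%R (@cd_re R S n) (@cd_re_is_linear S n).

Fact cd_scalar_is_linear S n : linear (@cd_scalar R S n).
Proof.
elim: n => [|n IH] a x y //=; apply: injective_projections => /=.
  exact: IH.
by rewrite scaler0 addr0.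
Qed.
HB.instance Definition _ S n :=
  GRing.isLinear.Build R S (CD S n) *:%R (@cd_scalar R S n)
    (@cd_scalar_is_linear S n).

Fact cd_im_is_linear S n : linear (@cd_im R S n).
Proof.
move=> a x y; rewrite /cd_im cd_re_is_linear cd_scalar_is_linear.
by rewrite opprD addrACA scalerBr.
Qed.
HB.instance Definition _ S n :=
  GRing.isLinear.Build R (CD S n) (CD S n) *:%R (@cd_im R S n)
    (@cd_im_is_linear S n).

Fact cd_map_is_linear S T (f : {linear S -> T}) n : linear (@cd_map R S T f n).
Proof.
elim: n => [|n IH] a x y /=; first exact: linearP.
by apply: injective_projections; apply: IH.
Qed.
HB.instance Definition _ S T (f : {linear S -> T}) n :=
  GRing.isLinear.Build R (CD S n) (CD T n) *:%R (@cd_map R S T f n)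
    (@cd_map_is_linear S T f n).

Fact cplx_of_is_linear S : linear (@cplx_of R S).
Proof.
by move=> a x y; apply: injective_projections; rewrite //= scaler0 addr0.
Qed.
HB.instance Definition _ S :=
  GRing.isLinear.Build R S (cplx S) *:%R (@cplx_of R S) (@cplx_of_is_linear S).

HB.instance Definition _ S :=
  GRing.isLinear.Build R (cplx S) S *:%R (@cplx_Re R S) (fun _ _ _ => erefl).

HB.instance Definition _ S :=
  GRing.isLinear.Build R (cplx S) S *:%R (@cplx_Im R S) (fun _ _ _ => erefl).

Fact cplx_iota_is_linear S : linear (@cplx_iota R S).
Proof.
by move=> a x y; apply: injective_projections; rewrite //= opprD scalerN.
Qed.
HB.instance Definition _ S :=
  GRing.isLinear.Build R (cplx S) (cplx S) *:%R (@cplx_iota R S)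
    (@cplx_iota_is_linear S).

Fact cd_conj_is_linear n : linear (@cd_conj R n).
Proof.
elim: n => [|n IH] a x y //=; apply: injective_projections => /=.
  exact: IH.
by rewrite opprD scalerN.
Qed.
HB.instance Definition _ n :=
  GRing.isLinear.Build R (CDalg R n) (CDalg R n) *:%R (@cd_conj R n)
    (@cd_conj_is_linear n).

(** Instances of linearity whose left-hand sides have a rigid head symbol: with
    the generic [linearD], matching tries to recognize every subterm as an
    application of a linear map, and unfolds the recursive definitions. *)
Lemma cd_scalarD S n (g h : S) :
  cd_scalar n (g + h) = cd_scalar n g + cd_scalar n h.
Proof. exact: linearD. Qed.

Lemma cd_scalarN S n (g : S) : cd_scalar n (- g) = - cd_scalar n g.
Proof. exact: linearN. Qed.

Lemma cd_scalarZ S n a (g : S) : cd_scalar n (a *: g) = a *: cd_scalar n g.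
Proof. exact: linearZ_LR. Qed.

Lemma cd_mapD S T (f : {linear S -> T}) n (x y : CD S n) :
  cd_map f (x + y) = cd_map f x + cd_map f y.
Proof. exact: linearD. Qed.

Lemma cd_mapN S T (f : {linear S -> T}) n (x : CD S n) :
  cd_map f (- x) = - cd_map f x.
Proof. exact: linearN. Qed.

Lemma cd_mapZ S T (f : {linear S -> T}) n a (x : CD S n) :
  cd_map f (a *: x) = a *: cd_map f x.
Proof. exact: linearZ_LR. Qed.

Lemma cd_re_scalar S n (g : S) : cd_re (cd_scalar n g) = g.
Proof. by elim: n => //= n ->. Qed.

Lemma cd_re_im S n (x : CD S n) : cd_re (cd_im x) = 0.
Proof. by rewrite /cd_im linearB /= cd_re_scalar subrr. Qed.

Lemma cd_re_map S T (f : S -> T) n (x : CD S n) :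
  cd_re (cd_map f x) = f (cd_re x).
Proof. by elim: n x => //= n IH x; apply: IH. Qed.

Lemma cd_map_scalar S T (f : {linear S -> T}) n g :
  cd_map f (cd_scalar n g) = cd_scalar n (f g).
Proof. by elim: n => //= n ->; rewrite linear0. Qed.

(** Replaces an element by gamma + s with gamma and s variables, so that
    rewriting rules for sums cannot fire inside the definition of [cd_im]. *)
Lemma cd_split_ind S n (P : CD S n -> Prop) :
  (forall g s, cd_re s = 0 -> P (cd_scalar n g + s)) -> forall x, P x.
Proof.
move=> Pgs x; have -> : x = cd_scalar n (cd_re x) + cd_im x.
  by rewrite addrC subrK.
exact/Pgs/cd_re_im.
Qed.

Lemma cd_re_split S n g (s : CD S n) :
  cd_re s = 0 -> cd_re (cd_scalar n g + s) = g.
Proof. by move=> s0; rewrite linearD /= s0 cd_re_scalar addr0. Qed.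

Lemma cd_im_split S n g (s : CD S n) :
  cd_re s = 0 -> cd_im (cd_scalar n g + s) = s.
Proof. by move=> s0; rewrite /cd_im cd_re_split // addrAC subrr add0r. Qed.

(** Linear forms separate points, so an identity between linear combinations of
    vectors may be checked in the field of scalars. *)
Lemma linear_form_ext S (x y : S) :
  (forall phi : {linear S -> R^o}, phi x = phi y) -> x = y.
Proof.
move=> E; rewrite (coord_vbasis (memvf x)) [RHS](coord_vbasis (memvf y)).
by apply: eq_bigr => i _; rewrite E.
Qed.

Lemma linear_formZ S (phi : {linear S -> R^o}) a x : phi (a *: x) = a * phi x.
Proof. exact: linearZ_LR. Qed.

Ltac module_ring :=
  apply: linear_form_ext; let phi := fresh "phi" in move=> phi;
  rewrite ?(linearD phi, linearN phi, linear_formZ phi, linear0 phi); by field.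

(** * The Cayley-Dickson product and its alternating part *)

(** Left and right linearity must be proved together: the doubling formula
    exchanges the two sides. *)
Fact cd_mul_is_bilinear n :
  (forall y : CDalg R n, linear (fun x => cd_mul x y)) /\
  (forall x : CDalg R n, linear (fun y => cd_mul x y)).
Proof.
elim: n => [|n [IHl IHr]] /=.
  split=> [y a x z | x a y z] /=; first by rewrite mulrDl scalerAl.
  by rewrite mulrDr scalerAr.
split=> [y a x z | x a y z]; apply: injective_projections => /=.
- by rewrite IHl IHr scalerBr opprD addrACA.
- by rewrite IHl IHr scalerDr addrACA.
- by rewrite cd_conj_is_linear IHl IHr scalerBr opprD addrACA.
- by rewrite cd_conj_is_linear IHl IHr scalerDr addrACA.
Qed.

HB.instance Definition _ n (x : CDalg R n) :=
  GRing.isLinear.Build R (CDalg R n) (CDalg R n) *:%R (cd_mul x)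
    (proj2 (cd_mul_is_bilinear n) x).

Lemma cd_mulDl n (x y z : CDalg R n) :
  cd_mul (x + y) z = cd_mul x z + cd_mul y z.
Proof. by have := proj1 (cd_mul_is_bilinear n) z 1 x y; rewrite !scale1r. Qed.

Lemma cd_mul0l n (z : CDalg R n) : cd_mul 0 z = 0.
Proof. by apply: (@addrI _ (cd_mul 0 z)); rewrite -cd_mulDl !addr0. Qed.

Lemma cd_mulZl n a (x z : CDalg R n) : cd_mul (a *: x) z = a *: cd_mul x z.
Proof.
have := proj1 (cd_mul_is_bilinear n) z a x 0.
by rewrite addr0 cd_mul0l addr0.
Qed.

Lemma cd_mulNl n (x z : CDalg R n) : cd_mul (- x) z = - cd_mul x z.
Proof. by rewrite -scaleN1r cd_mulZl scaleN1r. Qed.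

Lemma cd_mulDr n (x y z : CDalg R n) :
  cd_mul x (y + z) = cd_mul x y + cd_mul x z.
Proof. exact: linearD. Qed.

Lemma cd_mulZr n a (x y : CDalg R n) : cd_mul x (a *: y) = a *: cd_mul x y.
Proof. exact: linearZ_LR. Qed.

Lemma cd_mulNr n (x y : CDalg R n) : cd_mul x (- y) = - cd_mul x y.
Proof. exact: linearN. Qed.

Definition cd_mul_expand :=
  (cd_mulDl, cd_mulZl, cd_mulNl, cd_mulDr, cd_mulZr, cd_mulNr).

Definition cd_one n : CDalg R n := cd_scalar n (1 : R^o).

Lemma cd_scalarE n (r : R^o) : cd_scalar n r = (r : R) *: cd_one n.
Proof. by rewrite /cd_one -cd_scalarZ; congr cd_scalar; apply/esym/mulr1. Qed.

Lemma cd_conjE n (x : CDalg R n) : cd_conj x = cd_scalar n (cd_re x *+ 2) - x.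
Proof.
elim: n x => [|n IH] x /=; first by rewrite mulr2n addrK.
apply: injective_projections => /=; first exact: IH.
by rewrite sub0r.
Qed.

Lemma imaginaryE n (x : CDalg R n) : imaginary x <-> cd_re x = 0.
Proof.
rewrite /imaginary /= cd_conjE; split=> [|->]; last first.
  by rewrite mul0rn linear0 add0r.
move/(congr1 (@cd_re R R^o n)); rewrite linearB linearN /= cd_re_scalar.
by move/eqP; rewrite mulr2n -addrA subrr addr0; lra.
Qed.

Lemma cd_conj_imaginary n (x : CDalg R n) : cd_re x = 0 -> cd_conj x = - x.
Proof. by move/imaginaryE. Qed.

Lemma cd_conj_one n : cd_conj (cd_one n) = cd_one n.
Proof. by rewrite cd_conjE /cd_one cd_re_scalar mulr2n cd_scalarD addrK. Qed.

Lemma cd_conjK n (x : CDalg R n) : cd_conj (cd_conj x) = x.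
Proof. by elim: n x => //= n IH [x y] /=; rewrite IH opprK. Qed.

Lemma cd_mulr1_mul1r n (x : CDalg R n) :
  cd_mul x (cd_one n) = x /\ cd_mul (cd_one n) x = x.
Proof.
elim: n x => [|n IH] x; first by rewrite /= mulr1 mul1r.
case: (IH x.1) (IH x.2) (IH (cd_conj x.2)) => [xr xl] [yr yl] [zr zl].
split; apply: injective_projections => /=; rewrite -/(cd_one n).
- by rewrite linear0 cd_mul0l subr0.
- by rewrite cd_mul0l add0r cd_conj_one.
- by rewrite linear0 subr0.
- by rewrite cd_mul0l addr0.
Qed.

Lemma cd_mulr1 n (x : CDalg R n) : cd_mul x (cd_one n) = x.
Proof. exact: (proj1 (cd_mulr1_mul1r x)). Qed.

Lemma cd_mul1r n (x : CDalg R n) : cd_mul (cd_one n) x = x.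
Proof. exact: (proj2 (cd_mulr1_mul1r x)). Qed.

Fixpoint inner n : CDalg R n -> CDalg R n -> R :=
  if n is m.+1 then fun x y => inner x.1 y.1 + inner x.2 y.2
  else fun x y => (x : R) * (y : R).

Lemma innerC n (x y : CDalg R n) : inner x y = inner y x.
Proof.
by elim: n x y => [|n IH] x y /=; rewrite 1?mulrC // !(IH x.1, IH x.2).
Qed.

Lemma innerNl n (x y : CDalg R n) : inner (- x) y = - inner x y.
Proof. by elim: n x y => [|n IH] x y /=; rewrite ?mulNr // !IH opprD. Qed.

Lemma inner_conj n (x y : CDalg R n) :
  inner (cd_conj x) (cd_conj y) = inner x y.
Proof.
elim: n x y => //= n IH x y.
by rewrite IH innerNl [inner x.2 _]innerC innerNl opprK [inner y.2 _]innerC.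
Qed.

(** The polarized norm identity.  In the doubled algebra the second halves
    cancel, and the first half is the sum of the identity for the first halves
    of x and y and of the identity for the conjugates of their second halves. *)
Lemma cd_mul_conj_polar n (x y : CDalg R n) :
  cd_mul x (cd_conj y) + cd_mul y (cd_conj x) =
  cd_scalar n (inner x y *+ 2 : R^o).
Proof.
elim: n x y => [|n IH] x y /=; first by rewrite mulr2n [_ y x]mulrC.
apply: injective_projections => /=.
  rewrite !linearN !cd_mulNl !opprK /= addrACA IH.
  have := IH (cd_conj y.2) (cd_conj x.2); rewrite !cd_conjK => ->.
  by rewrite inner_conj -linearD -mulrnDl [inner y.2 _]innerC.
by rewrite !cd_conjK !cd_mulNl [X in _ + X]addrC addrACA addNr subrr addr0.
Qed.

Fact cross_is_linear n (x : CDalg R n) : linear (cross x).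
Proof. by move=> a y z; rewrite /cross !cd_mul_expand; module_ring. Qed.
HB.instance Definition _ n (x : CDalg R n) :=
  GRing.isLinear.Build R (CDalg R n) (CDalg R n) *:%R (cross x)
    (@cross_is_linear n x).

Lemma crossC n (x y : CDalg R n) : cross x y = - cross y x.
Proof. by rewrite /cross -scalerN opprB. Qed.

Lemma crossDr n (x y z : CDalg R n) : cross x (y + z) = cross x y + cross x z.
Proof. exact: linearD. Qed.

Lemma crossNr n (x y : CDalg R n) : cross x (- y) = - cross x y.
Proof. exact: linearN. Qed.

Lemma crossDl n (x y z : CDalg R n) : cross (x + y) z = cross x z + cross y z.
Proof. by rewrite crossC crossDr opprD (crossC x) (crossC y). Qed.

Lemma crossNl n (x z : CDalg R n) : cross (- x) z = - cross x z.
Proof. by rewrite crossC crossNr (crossC x). Qed.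

Lemma cross_A1 (X Y : CDalg R 1) : cross X Y = 0.
Proof.
apply/eqP; rewrite scaler_eq0 subr_eq0; apply/orP; right; apply/eqP.
by apply: injective_projections => /=; ring.
Qed.

Lemma cd_mul_imaginary n (x y : CDalg R n) : cd_re x = 0 -> cd_re y = 0 ->
  cd_mul x y = cross x y - inner x y *: cd_one n.
Proof.
move=> x0 y0; have := cd_mul_conj_polar x y.
rewrite !cd_conj_imaginary // !cd_mulNr cd_scalarE => E.
have -> : inner x y *: cd_one n = 2^-1 *: (- cd_mul x y - cd_mul y x).
  by rewrite E scalerA; congr (_ *: _); field.
rewrite /cross; module_ring.
Qed.

(** In the second half, the doubling formula produces the products t u and s v,
    in this order, of imaginary elements; their scalar parts give
    <s, v> - <t, u>, and t × u = - u × t. *)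
Lemma cross_double n (u v s t : CDalg R n) (gamma delta : R) :
  cd_re u = 0 -> cd_re v = 0 -> cd_re s = 0 -> cd_re t = 0 ->
  cross ((u, gamma *: cd_one n + s) : CDalg R n.+1)
        ((v, delta *: cd_one n + t) : CDalg R n.+1) =
  (cross u v - cross s t + gamma *: t - delta *: s,
   (inner s v - inner t u) *: cd_one n + delta *: u - gamma *: v
   - (cross u t + cross s v)).
Proof.
move=> u0 v0 s0 t0; apply: injective_projections => /=.
  rewrite !cd_conj_is_linear !cd_conj_one.
  rewrite !(cd_conj_imaginary s0, cd_conj_imaginary t0).
  by rewrite /cross !cd_mul_expand !cd_mulr1 !cd_mul1r; module_ring.
rewrite !(cd_conj_imaginary u0, cd_conj_imaginary v0) !cd_mul_expand !cd_mul1r.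
by rewrite (cd_mul_imaginary t0 u0) (cd_mul_imaginary s0 v0) (crossC t u);
  module_ring.
Qed.

(** Expanding x = a + u and y = b + v, the polarized norm identity for x and
    conj(y) identifies <x, conj(y)> with a b - <u, v>. *)
Lemma cd_mul_split n (x y : CDalg R n) :
  cd_mul x y = cd_scalar n (inner x (cd_conj y) : Ro)
    + (cd_re x : R) *: cd_im y + (cd_re y : R) *: cd_im x
    + cross (cd_im x) (cd_im y).
Proof.
have := cd_mul_conj_polar x (cd_conj y); rewrite cd_conjK.
elim/cd_split_ind: x => a u u0; elim/cd_split_ind: y => b v v0.
rewrite !cd_re_split // !cd_im_split // !cd_scalarE.
move: (inner _ _) => p.
rewrite !cd_conj_is_linear !cd_conj_one.
rewrite !(cd_conj_imaginary u0, cd_conj_imaginary v0).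
rewrite /cross !cd_mul_expand !cd_mulr1 !cd_mul1r => E.
have -> : p *: cd_one n = 2^-1 *: ((p *+ 2) *: cd_one n).
  by rewrite scalerA; congr (_ *: _); field.
by rewrite -E; module_ring.
Qed.

(** * Values of the elementary programs *)

Definition scal_mul (a b : Ro) : Ro := (a : R) * (b : R).

Local Notation rec T := (recorded Ro Ro T).
Local Notation rmul := (real_mul scal_mul).
Local Notation cmul := (cplx_mul scal_mul).

Lemma CRe_iota n (x : CD (cplx Ro) n) : CRe (iota Ro x) = - CIm x.
Proof. by elim: n x => //= n IH x; rewrite !IH. Qed.

Lemma CIm_iota n (x : CD (cplx Ro) n) : CIm (iota Ro x) = CRe x.
Proof. by elim: n x => //= n IH x; rewrite !IH. Qed.

Lemma CRe_of n (x : CD Ro n) : CRe (of_real Ro x) = x.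
Proof. by elim: n x => //= n IH [x y] /=; rewrite !IH. Qed.

Lemma CIm_of n (x : CD Ro n) : CIm (of_real Ro x) = 0.
Proof. by elim: n x => //= n IH x; rewrite !IH. Qed.

Lemma CRe_plus n (x y : CD (cplx Ro) n) : CRe (x + iota Ro y) = CRe x - CIm y.
Proof. by rewrite cd_mapD CRe_iota. Qed.

Lemma CIm_plus n (x y : CD (cplx Ro) n) : CIm (x + iota Ro y) = CIm x + CRe y.
Proof. by rewrite cd_mapD CIm_iota. Qed.

Lemma CRe_minus n (x y : CD (cplx Ro) n) : CRe (x - iota Ro y) = CRe x + CIm y.
Proof. by rewrite cd_mapD cd_mapN CRe_iota opprK. Qed.

Lemma CIm_minus n (x y : CD (cplx Ro) n) : CIm (x - iota Ro y) = CIm x - CRe y.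
Proof. by rewrite cd_mapD cd_mapN CIm_iota. Qed.

Lemma dot_rmul n (x y : CD Ro n) : (dot rmul x y).1 = inner x y.
Proof. by elim: n x y => //= n IH x y; rewrite !IH. Qed.

Lemma dot_im_rmul n (x y : CD Ro n) :
  cd_re x = 0 -> (dot_im rmul x y).1 = inner x y.
Proof.
elim: n x y => /= [|n IH] x y x0; first by rewrite x0 mul0r.
by rewrite IH // dot_rmul.
Qed.

Lemma cmulE (z w : cplx Ro) : (cmul z w).1 =
  ((z.1 : R) * w.1 - (z.2 : R) * w.2 : R, (z.1 : R) * w.2 + (z.2 : R) * w.1 : R).
Proof. by congr (_, _); rewrite /= /scal_mul; ring. Qed.

Lemma dot_cmul n (x y : CD (cplx Ro) n) : (dot cmul x y).1 =
  (inner (CRe x) (CRe y) - inner (CIm x) (CIm y),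
   inner (CRe x) (CIm y) + inner (CIm x) (CRe y)).
Proof.
elim: n x y => [|n IH] x y; first exact: cmulE.
by rewrite /= !IH; apply: injective_projections => /=; ring.
Qed.

Lemma dot_im_cmul n (x y : CD (cplx Ro) n) : cd_re x = 0 ->
  (dot_im cmul x y).1 =
  (inner (CRe x) (CRe y) - inner (CIm x) (CIm y),
   inner (CRe x) (CIm y) + inner (CIm x) (CRe y)).
Proof.
elim: n x y => [|n IH] x y /= x0.
  by rewrite x0 /= !mul0r subr0 addr0.
by rewrite IH // dot_cmul; apply: injective_projections => /=; ring.
Qed.

Lemma mapM_val S T (f : S -> rec T) n (x : CD S n) :
  (mapM f x).1 = cd_map (fst \o f) x.
Proof. by elim: n x => //= n IH x; rewrite !IH. Qed.

Lemma mapM_im_val S T (f : S -> rec T) n (x : CD S n) :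
  (f 0).1 = 0 -> cd_re x = 0 -> (mapM_im f x).1 = cd_map (fst \o f) x.
Proof.
move=> f0; elim: n x => [|n IH] x /= x0; first by rewrite x0 f0.
by rewrite IH // mapM_val.
Qed.

Lemma mapM_im_rmull n (a : R) (x : CD Ro n) : cd_re x = 0 ->
  (mapM_im (fun b => rmul a b) x).1 = a *: x.
Proof.
move=> x0; rewrite mapM_im_val //=; last by rewrite /scal_mul mulr0.
by elim: n x {x0} => //= n IH [x y] /=; rewrite !IH.
Qed.

Lemma mapM_im_rmulr n (a : R) (x : CD Ro n) : cd_re x = 0 ->
  (mapM_im (fun b => rmul b a) x).1 = a *: x.
Proof.
move=> x0; rewrite mapM_im_val //=; last by rewrite /scal_mul mul0r.
elim: n x {x0} => [|n IH] x /=; first exact: mulrC.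
by rewrite !IH.
Qed.

Definition cscale n (c : cplx Ro) (x : CD (cplx Ro) n) :=
  cd_map (fun b => (cmul c b).1) x.

Lemma mapM_im_cmull n c (x : CD (cplx Ro) n) : cd_re x = 0 ->
  (mapM_im (fun b => cmul c b) x).1 = cscale c x.
Proof.
by move=> x0; rewrite mapM_im_val // cmulE /= !mulr0 subr0 addr0.
Qed.

Lemma mapM_im_cmulr n c (x : CD (cplx Ro) n) : cd_re x = 0 ->
  (mapM_im (fun b => cmul b c) x).1 = cscale c x.
Proof.
move=> x0; rewrite mapM_im_val //; last by rewrite cmulE /= !mul0r subr0 addr0.
rewrite /cscale; elim: n x {x0} => [|n IH] x /=; last by rewrite !IH.
by apply: injective_projections; rewrite /= /scal_mul; ring.
Qed.

Lemma CRe_cscale n c (x : CD (cplx Ro) n) :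
  CRe (cscale c x) = (c.1 : R) *: CRe x - (c.2 : R) *: CIm x.
Proof.
by elim: n x => [|n IH] x //; apply: injective_projections; apply: IH.
Qed.

Lemma CIm_cscale n c (x : CD (cplx Ro) n) :
  CIm (cscale c x) = (c.1 : R) *: CIm x + (c.2 : R) *: CRe x.
Proof.
elim: n x => [|n IH] x; last by apply: injective_projections; apply: IH.
by rewrite /= /scal_mul /GRing.scale /= /cplx_Im /cplx_Re; ring.
Qed.

(** * Correctness of the algorithms *)

Definition post (T T' : Type) (phi : T -> T') (p : rec T) : rec T' :=
  (phi p.1, p.2).

Definition both (T T' : Type) (p : rec T) (q : rec T') : rec (T * T') :=
  ((p.1, q.1), p.2 ++ q.2).

(** Successive bindings none of which depends on an earlier result amount to
    juxtaposition followed by post-processing. *)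
Lemma bind2 (T1 T2 T : Type) (F : T1 -> T2 -> T) (p1 : rec T1) (p2 : rec T2) :
  bind p1 (fun a1 => bind p2 (fun a2 => ret _ _ (F a1 a2))) =
  post (fun z => F z.1 z.2) (both p1 p2).
Proof. by rewrite /bind /= cats0. Qed.

Lemma bind3 (T1 T2 T3 T : Type) (F : T1 -> T2 -> T3 -> T)
    (p1 : rec T1) (p2 : rec T2) (p3 : rec T3) :
  bind p1 (fun a1 => bind p2 (fun a2 => bind p3 (fun a3 =>
    ret _ _ (F a1 a2 a3)))) =
  post (fun z => F z.1 z.2.1 z.2.2) (both p1 (both p2 p3)).
Proof. by rewrite /bind /= cats0. Qed.

Lemma bind7 (T1 T2 T3 T4 T5 T6 T7 T : Type)
    (F : T1 -> T2 -> T3 -> T4 -> T5 -> T6 -> T7 -> T)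
    (p1 : rec T1) (p2 : rec T2) (p3 : rec T3) (p4 : rec T4) (p5 : rec T5)
    (p6 : rec T6) (p7 : rec T7) :
  bind p1 (fun a1 => bind p2 (fun a2 => bind p3 (fun a3 => bind p4 (fun a4 =>
  bind p5 (fun a5 => bind p6 (fun a6 => bind p7 (fun a7 =>
    ret _ _ (F a1 a2 a3 a4 a5 a6 a7)))))))) =
  post (fun z => F z.1 z.2.1 z.2.2.1 z.2.2.2.1 z.2.2.2.2.1 z.2.2.2.2.2.1
                   z.2.2.2.2.2.2)
    (both p1 (both p2 (both p3 (both p4 (both p5 (both p6 p7)))))).
Proof. by rewrite /bind /= cats0. Qed.

Lemma bind8 (T1 T2 T3 T4 T5 T6 T7 T8 T : Type)
    (F : T1 -> T2 -> T3 -> T4 -> T5 -> T6 -> T7 -> T8 -> T)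
    (p1 : rec T1) (p2 : rec T2) (p3 : rec T3) (p4 : rec T4) (p5 : rec T5)
    (p6 : rec T6) (p7 : rec T7) (p8 : rec T8) :
  bind p1 (fun a1 => bind p2 (fun a2 => bind p3 (fun a3 => bind p4 (fun a4 =>
  bind p5 (fun a5 => bind p6 (fun a6 => bind p7 (fun a7 => bind p8 (fun a8 =>
    ret _ _ (F a1 a2 a3 a4 a5 a6 a7 a8))))))))) =
  post (fun z => F z.1 z.2.1 z.2.2.1 z.2.2.2.1 z.2.2.2.2.1 z.2.2.2.2.2.1
                   z.2.2.2.2.2.2.1 z.2.2.2.2.2.2.2)
    (both p1 (both p2 (both p3 (both p4 (both p5 (both p6 (both p7 p8))))))).
Proof. by rewrite /bind /= cats0. Qed.

Definition C_combine m
    (z : CD (cplx Ro) m * (CD (cplx Ro) m * (cplx Ro * (cplx Ro *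
         (CD (cplx Ro) m * (CD (cplx Ro) m *
          (CD (cplx Ro) m * CD (cplx Ro) m)))))))
    : CD (cplx Ro) m.+1 :=
  let: (Zp, (Zm, (sv, (ut, (gamma_t, (s_delta, (u_delta, gamma_v))))))) := z in
  (2^-1 *: (Zp + Zm) + gamma_t - s_delta,
   cd_scalar m (sv - ut) + u_delta - gamma_v + 2^-1 *: iota Ro (Zp - Zm)).

Definition R_combine m
    (z : CD (cplx Ro) m *
         (Ro * (Ro * (CD Ro m * (CD Ro m * (CD Ro m * CD Ro m))))))
    : CD Ro m.+1 :=
  let: (Z, (sv, (ut, (gamma_t, (s_delta, (u_delta, gamma_v)))))) := z in
  (CRe Z + gamma_t - s_delta,
   cd_scalar m (sv - ut) + u_delta - gamma_v - CIm Z).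

Lemma C_algE m (u b v c : CD (cplx Ro) m) : (0 < m)%N ->
  C_alg scal_mul ((u, b) : CD _ m.+1) ((v, c) : CD _ m.+1) =
  post (@C_combine m)
    (both (C_alg scal_mul (u + iota Ro (cd_im b)) (v + iota Ro (cd_im c)))
    (both (C_alg scal_mul (u - iota Ro (cd_im b)) (v - iota Ro (cd_im c)))
    (both (dot_im cmul (cd_im b) v)
    (both (dot_im cmul u (cd_im c))
    (both (mapM_im (fun y => cmul (cd_re b) y) (cd_im c))
    (both (mapM_im (fun x => cmul x (cd_re c)) (cd_im b))
    (both (mapM_im (fun x => cmul x (cd_re c)) u)
          (mapM_im (fun y => cmul (cd_re b) y) v)))))))).
Proof. by case: m u b v c => // m u b v c _; apply: bind8. Qed.

Lemma R_algE m (u b v c : CD Ro m) : (0 < m)%N ->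
  R_alg scal_mul ((u, b) : CD _ m.+1) ((v, c) : CD _ m.+1) =
  post (@R_combine m)
    (both (C_alg scal_mul
             (of_real Ro u + iota Ro (of_real Ro (cd_im b)))
             (of_real Ro v + iota Ro (of_real Ro (cd_im c))))
    (both (dot_im rmul (cd_im b) v)
    (both (dot_im rmul u (cd_im c))
    (both (mapM_im (fun y => rmul (cd_re b) y) (cd_im c))
    (both (mapM_im (fun x => rmul x (cd_re c)) (cd_im b))
    (both (mapM_im (fun x => rmul x (cd_re c)) u)
          (mapM_im (fun y => rmul (cd_re b) y) v))))))).
Proof. by case: m u b v c => // m u b v c _; apply: bind7. Qed.

Lemma C_alg_val m (u s v t : CD (cplx Ro) m) (gamma delta : cplx Ro) :
  (0 < m)%N -> cd_re u = 0 -> cd_re s = 0 -> cd_re v = 0 -> cd_re t = 0 ->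
  let Zp := (C_alg scal_mul (u + iota Ro s) (v + iota Ro t)).1 in
  let Zm := (C_alg scal_mul (u - iota Ro s) (v - iota Ro t)).1 in
  (C_alg scal_mul ((u, cd_scalar m gamma + s) : CD _ m.+1)
                  ((v, cd_scalar m delta + t) : CD _ m.+1)).1 =
  (2^-1 *: (Zp + Zm) + cscale gamma t - cscale delta s,
   cd_scalar m ((dot_im cmul s v).1 - (dot_im cmul u t).1)
   + cscale delta u - cscale gamma v + 2^-1 *: iota Ro (Zp - Zm)).
Proof.
move=> m_gt0 u0 s0 v0 t0 Zp Zm; rewrite C_algE // !cd_re_split // !cd_im_split //.
rewrite -(mapM_im_cmull gamma t0) -(mapM_im_cmulr delta s0).
by rewrite -(mapM_im_cmull gamma v0) -(mapM_im_cmulr delta u0).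
Qed.

Lemma R_alg_val m (u s v t : CD Ro m) (gamma delta : Ro) :
  (0 < m)%N -> cd_re u = 0 -> cd_re s = 0 -> cd_re v = 0 -> cd_re t = 0 ->
  let Z := (C_alg scal_mul (of_real Ro u + iota Ro (of_real Ro s))
                           (of_real Ro v + iota Ro (of_real Ro t))).1 in
  (R_alg scal_mul ((u, cd_scalar m gamma + s) : CD _ m.+1)
                  ((v, cd_scalar m delta + t) : CD _ m.+1)).1 =
  (CRe Z + (gamma : R) *: t - (delta : R) *: s,
   cd_scalar m ((dot_im rmul s v).1 - (dot_im rmul u t).1)
   + (delta : R) *: u - (gamma : R) *: v - CIm Z).
Proof.
move=> m_gt0 u0 s0 v0 t0 Z; rewrite R_algE // !cd_re_split // !cd_im_split //.
rewrite -(mapM_im_rmull gamma t0) -(mapM_im_rmulr delta s0).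
by rewrite -(mapM_im_rmull gamma v0) -(mapM_im_rmulr delta u0).
Qed.

(** The right-hand sides are the real and imaginary parts of the complex
    bilinear extension of the cross product.  After [cross_double] has been
    applied to the four real cross products, the claim is an identity between
    linear combinations of cross products and inner products of the real and
    imaginary parts of u, v, s, t. *)
Lemma C_algP n (X Y : CD (cplx Ro) n) :
  (0 < n)%N -> cd_re X = 0 -> cd_re Y = 0 ->
  CRe (C_alg scal_mul X Y).1 =
    cross (CRe X) (CRe Y) - cross (CIm X) (CIm Y) /\
  CIm (C_alg scal_mul X Y).1 =
    cross (CRe X) (CIm Y) + cross (CIm X) (CRe Y).
Proof.
elim: n X Y => [//|m IH] X Y _ X0 Y0.
case: (posnP m) => [m0|m_gt0].
  move: X Y X0 Y0; rewrite m0 => X Y _ _.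
  have -> : (C_alg scal_mul X Y).1 = 0 by [].
  by rewrite !linear0 !cross_A1 subr0 addr0.
case: X Y X0 Y0 => [u b] [v c] u0 v0.
change (cd_re (u : CD (cplx Ro) m) = 0) in u0.
change (cd_re (v : CD (cplx Ro) m) = 0) in v0.
elim/cd_split_ind: b => g s s0; elim/cd_split_ind: c => d t t0.
rewrite (C_alg_val g d m_gt0 u0 s0 v0 t0).
rewrite (dot_im_cmul _ s0) (dot_im_cmul _ u0).
have re0 (x : CD (cplx Ro) m) : cd_re x = 0 -> cd_re (CRe x) = 0.
  by rewrite cd_re_map => ->.
have im0 (x : CD (cplx Ro) m) : cd_re x = 0 -> cd_re (CIm x) = 0.
  by rewrite cd_re_map => ->.
have iota0 (x : CD (cplx Ro) m) : cd_re x = 0 -> cd_re (iota Ro x) = 0.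
  by rewrite cd_re_map => ->; rewrite linear0.
have plus0 (x y : CD (cplx Ro) m) :
    cd_re x = 0 -> cd_re y = 0 -> cd_re (x + iota Ro y) = 0.
  by move=> x0 y0; rewrite linearD /= x0 iota0 // addr0.
have minus0 (x y : CD (cplx Ro) m) :
    cd_re x = 0 -> cd_re y = 0 -> cd_re (x - iota Ro y) = 0.
  by move=> x0 y0; rewrite linearB /= x0 iota0 // subr0.
have [ZpR ZpI] := IH _ _ m_gt0 (plus0 _ _ u0 s0) (plus0 _ _ v0 t0).
have [ZmR ZmI] := IH _ _ m_gt0 (minus0 _ _ u0 s0) (minus0 _ _ v0 t0).
move: (C_alg _ (u + _) _).1 (C_alg _ (u - _) _).1 ZpR ZpI ZmR ZmI => Zp Zm.
rewrite !CRe_plus !CIm_plus !CRe_minus !CIm_minus => ZpR ZpI ZmR ZmI.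
have CRe_pair (x y : CD (cplx Ro) m) :
  CRe ((x, y) : CD _ m.+1) = (CRe x, CRe y) by [].
have CIm_pair (x y : CD (cplx Ro) m) :
  CIm ((x, y) : CD _ m.+1) = (CIm x, CIm y) by [].
have CRe_scalar x : CRe (cd_scalar m x) = (x.1 : R) *: cd_one m.
  by rewrite cd_map_scalar cd_scalarE.
have CIm_scalar x : CIm (cd_scalar m x) = (x.2 : R) *: cd_one m.
  by rewrite cd_map_scalar cd_scalarE.
rewrite !CRe_pair !CIm_pair !(cd_mapD, cd_mapN, cd_mapZ) !CRe_iota !CIm_iota.
rewrite ZpR ZpI ZmR ZmI !CRe_cscale !CIm_cscale !CRe_scalar !CIm_scalar.
rewrite !cross_double ?re0 ?im0 //.
move: (CRe u) (CIm u) (CRe v) (CIm v) (CRe s) (CIm s) (CRe t) (CIm t).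
move=> ur ui vr vi sr si tr ti {re0 im0 iota0 plus0 minus0 IH ZpR ZpI ZmR ZmI}.
rewrite !(crossDl, crossNl, crossDr, crossNr).
rewrite (innerC ur tr) (innerC ui ti) (innerC ur ti) (innerC ui tr).
by split; apply: injective_projections => /=; module_ring.
Qed.

Lemma R_algP n (X Y : CD Ro n) :
  (0 < n)%N -> cd_re X = 0 -> cd_re Y = 0 ->
  (R_alg scal_mul X Y).1 = cross X Y.
Proof.
case: n X Y => [//|m] X Y _ X0 Y0.
case: (posnP m) => [m0|m_gt0].
  by move: X Y X0 Y0; rewrite m0 => X Y _ _; rewrite cross_A1.
case: X Y X0 Y0 => [u b] [v c] u0 v0.
change (cd_re (u : CD Ro m) = 0) in u0.
change (cd_re (v : CD Ro m) = 0) in v0.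
elim/cd_split_ind: b => g s s0; elim/cd_split_ind: c => d t t0.
rewrite (R_alg_val g d m_gt0 u0 s0 v0 t0).
rewrite (dot_im_rmul _ s0) (dot_im_rmul _ u0).
have plus0 (x y : CD Ro m) : cd_re x = 0 -> cd_re y = 0 ->
    cd_re (of_real Ro x + iota Ro (of_real Ro y)) = 0.
  by move=> x0 y0; rewrite linearD /= !cd_re_map x0 y0 !linear0 addr0.
have [ZR ZI] := C_algP m_gt0 (plus0 _ _ u0 s0) (plus0 _ _ v0 t0).
rewrite ZR ZI !CRe_plus !CIm_plus !CRe_of !CIm_of subr0 add0r subr0 add0r.
rewrite !(cd_scalarE _ g) !(cd_scalarE _ d) cross_double //.
by rewrite cd_scalarE (innerC u t).
Qed.

(** * Counting products *)

(** A pair of linear forms to be multiplied, with the vector by which their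
    product enters the result. *)
Definition product_term U1 U2 T : Type :=
  ({linear U1 -> Ro} * {linear U2 -> Ro} * T)%type.

Definition factors (U1 U2 T : vectType R) (p : product_term U1 U2 T) x y :
  Ro * Ro := (p.1.1 x, p.1.2 y).

Definition run (U1 U2 T : vectType R) (s : seq (product_term U1 U2 T)) x y :
    rec T :=
  (\sum_(p <- s) scal_mul (factors p x y).1 (factors p x y).2 *: p.2,
   [seq factors p x y | p <- s]).

(** Value and record are produced by one list of terms, so a single induction
    yields both the number of recorded products, with factors that are linear
    forms in the inputs, and a tensor decomposition of the computed map. *)
Definition bilinear_program (U1 U2 T : vectType R) r (f : U1 -> U2 -> rec T) :=
  exists2 s : seq (product_term U1 U2 T), size s = r &
    forall x y, f x y = run s x y.

Section Programs.
Variables U1 U2 : vectType R.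

Lemma prog_ext T r (f g : U1 -> U2 -> rec T) :
  (forall x y, f x y = g x y) -> bilinear_program r g -> bilinear_program r f.
Proof. by move=> fg [s sr gE]; exists s => // x y; rewrite fg gE. Qed.

Lemma prog0 T : bilinear_program 0 (fun (_ : U1) (_ : U2) => ret _ _ (0 : T)).
Proof. by exists [::] => // x y; rewrite /run big_nil. Qed.

Lemma prog_comp (U1' U2' : vectType R) T r (f : U1 -> U2 -> rec T)
    (A : {linear U1' -> U1}) (B : {linear U2' -> U2}) :
  bilinear_program r f -> bilinear_program r (fun x y => f (A x) (B y)).
Proof.
move=> [s sr fE].
pose termAB (p : product_term U1 U2 T) : product_term U1' U2' T :=
  (p.1.1 \o A : {linear U1' -> Ro}, p.1.2 \o B : {linear U2' -> Ro}, p.2).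
exists [seq termAB p | p <- s]; first by rewrite size_map.
by move=> x y; rewrite fE /run big_map -map_comp.
Qed.

Lemma prog_post T T' r (f : U1 -> U2 -> rec T) (phi : T -> T') :
  linear phi ->
  bilinear_program r f -> bilinear_program r (fun x y => post phi (f x y)).
Proof.
move=> phi_lin [s sr fE].
exists [seq (p.1, phi p.2) : product_term U1 U2 T'
       | p : product_term U1 U2 T <- s]; first by rewrite size_map.
pose phiM := GRing.isLinear.Build _ _ _ _ _ phi_lin.
pose phiL : {linear T -> T'} := HB.pack phi phiM.
move=> x y; rewrite /post fE /run big_map -map_comp.
congr (_, _); rewrite -[phi]/(phiL : T -> T') linear_sum.
by apply: eq_bigr => p _; rewrite linearZ.
Qed.

Lemma prog_both T T' r r' (f : U1 -> U2 -> rec T) (g : U1 -> U2 -> rec T') :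
  bilinear_program r f -> bilinear_program r' g ->
  bilinear_program (r + r') (fun x y => both (f x y) (g x y)).
Proof.
move=> [s sr fE] [t tr gE].
pose sl := [seq (p.1, (p.2, 0)) : product_term U1 U2 (T * T')%type
           | p : product_term U1 U2 T <- s].
pose tl := [seq (p.1, (0, p.2)) : product_term U1 U2 (T * T')%type
           | p : product_term U1 U2 T' <- t].
exists (sl ++ tl); first by rewrite size_cat !size_map sr tr.
move=> x y; rewrite /both fE gE /run big_cat !big_map map_cat -!map_comp.
congr (_, _); apply: injective_projections => /=.
  rewrite !(raddf_sum fst) /=.
  by rewrite [X in _ + X]big1 ?addr0 // => p _; rewrite scaler0.
rewrite !(raddf_sum snd) /=.
by rewrite [X in X + _]big1 ?add0r // => p _; rewrite scaler0.
Qed.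

End Programs.

Lemma prog_rmul : bilinear_program 1 rmul.
Proof.
pose id := idfun : {linear Ro -> Ro}.
exists [:: (id, id, 1 : Ro)] => // x y.
rewrite /run big_seq1 /= /real_mul /scal_mul; congr (_, _).
exact/esym/mulr1.
Qed.

Lemma prog_cmul : bilinear_program 3 cmul.
Proof.
apply: prog_ext => [z w|]; first exact: bind3.
apply: prog_post => [a x y|].
  by apply: injective_projections => /=; module_ring.
apply: (@prog_both _ _ _ _ 1 2); first exact: (prog_comp fst fst prog_rmul).
apply: (@prog_both _ _ _ _ 1 1); first exact: (prog_comp snd snd prog_rmul).
exact: (prog_comp (fst \+ snd) (fst \+ snd) prog_rmul).
Qed.

Section VectorOperations.
Variables (S1 S2 S3 : vectType R) (k : nat) (f : S1 -> S2 -> rec S3).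
Hypothesis progf : bilinear_program k f.

Lemma prog_dot n : bilinear_program (k * 2 ^ n) (@dot _ _ _ _ _ _ f n).
Proof.
elim: n => [|n IH]; first by rewrite muln1.
apply: prog_ext => [x y|]; first exact: bind2.
rewrite expnS mul2n -addnn mulnDr.
apply: prog_post => [a x y|]; first by rewrite /=; module_ring.
apply: prog_both; first exact: (prog_comp fst fst IH).
exact: (prog_comp snd snd IH).
Qed.

Lemma prog_dot_im n :
  bilinear_program (k * (2 ^ n - 1)) (@dot_im _ _ _ _ _ _ f n).
Proof.
elim: n => [|n IH]; first by rewrite muln0; apply: prog0.
apply: prog_ext => [x y|]; first exact: bind2.
rewrite expnS mul2n -addnn -addnBAC ?expn_gt0 // mulnDr.
apply: prog_post => [a x y|]; first by rewrite /=; module_ring.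
apply: prog_both; first exact: (prog_comp fst fst IH).
exact: (prog_comp snd snd (prog_dot n)).
Qed.

Lemma prog_mapMr n :
  bilinear_program (k * 2 ^ n) (fun x (y : CD S2 n) => mapM (f x) y).
Proof.
elim: n => [|n IH]; first by rewrite muln1.
apply: prog_ext => [x y|]; first exact: bind2.
rewrite expnS mul2n -addnn mulnDr; apply: prog_post => //.
apply: prog_both; first exact: (prog_comp idfun fst IH).
exact: (prog_comp idfun snd IH).
Qed.

Lemma prog_mapM_imr n :
  bilinear_program (k * (2 ^ n - 1)) (fun x (y : CD S2 n) => mapM_im (f x) y).
Proof.
elim: n => [|n IH]; first by rewrite muln0; apply: prog0.
apply: prog_ext => [x y|]; first exact: bind2.
rewrite expnS mul2n -addnn -addnBAC ?expn_gt0 // mulnDr; apply: prog_post => //.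
apply: prog_both; first exact: (prog_comp idfun fst IH).
exact: (prog_comp idfun snd (prog_mapMr n)).
Qed.

Lemma prog_mapMl n :
  bilinear_program (k * 2 ^ n) (fun (x : CD S1 n) y => mapM (fun a => f a y) x).
Proof.
elim: n => [|n IH]; first by rewrite muln1.
apply: prog_ext => [x y|]; first exact: bind2.
rewrite expnS mul2n -addnn mulnDr; apply: prog_post => //.
apply: prog_both; first exact: (prog_comp fst idfun IH).
exact: (prog_comp snd idfun IH).
Qed.

Lemma prog_mapM_iml n :
  bilinear_program (k * (2 ^ n - 1))
    (fun (x : CD S1 n) y => mapM_im (fun a => f a y) x).
Proof.
elim: n => [|n IH]; first by rewrite muln0; apply: prog0.
apply: prog_ext => [x y|]; first exact: bind2.
rewrite expnS mul2n -addnn -addnBAC ?expn_gt0 // mulnDr; apply: prog_post => //.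
apply: prog_both; first exact: (prog_comp fst idfun IH).
exact: (prog_comp snd idfun (prog_mapMl n)).
Qed.

End VectorOperations.

Section LinearParts.
Variables (S : vectType R) (m : nat).

(** The projections of a pair, retyped: the type of [fst] would mention the
    unfolded recursion instead of [CD S m]. *)
Definition cd_fst (x : CD S m.+1) : CD S m := x.1.
Definition cd_snd (x : CD S m.+1) : CD S m := x.2.

HB.instance Definition _ :=
  GRing.isLinear.Build R (CD S m.+1) (CD S m) *:%R cd_fst (fun _ _ _ => erefl).
HB.instance Definition _ :=
  GRing.isLinear.Build R (CD S m.+1) (CD S m) *:%R cd_snd (fun _ _ _ => erefl).

Definition cd_snd_re : {linear CD S m.+1 -> S} := @cd_re R S m \o cd_snd.
Definition cd_snd_im : {linear CD S m.+1 -> CD S m} := @cd_im R S m \o cd_snd.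

End LinearParts.

Section RecursiveInputs.
Variables (S : vectType R) (m : nat).
Let iota_m := @cd_map R _ _ (@cplx_iota R S) m.
Let of_real_m := @cd_map R _ _ (@cplx_of R S) m.

Definition plus_iota : {linear CD (cplx S) m.+1 -> CD (cplx S) m} :=
  @cd_fst (cplx S) m \+ (iota_m \o @cd_snd_im (cplx S) m).
Definition minus_iota : {linear CD (cplx S) m.+1 -> CD (cplx S) m} :=
  @cd_fst (cplx S) m \- (iota_m \o @cd_snd_im (cplx S) m).
Definition real_plus_iota : {linear CD S m.+1 -> CD (cplx S) m} :=
  (of_real_m \o @cd_fst S m) \+ (iota_m \o (of_real_m \o @cd_snd_im S m)).

End RecursiveInputs.

Lemma prog_vector_operations (S : vectType R) (smul : S -> S -> rec S) k m :
  bilinear_program k smul ->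
  bilinear_program (k * (2 ^ m - 1) * 6)
    (fun X Y : CD S m.+1 =>
    (both (dot_im smul (cd_im X.2) Y.1)
    (both (dot_im smul X.1 (cd_im Y.2))
    (both (mapM_im (fun y => smul (cd_re X.2) y) (cd_im Y.2))
    (both (mapM_im (fun x => smul x (cd_re Y.2)) (cd_im X.2))
    (both (mapM_im (fun x => smul x (cd_re Y.2)) X.1)
          (mapM_im (fun y => smul (cd_re X.2) y) Y.1))))))).
Proof.
move=> prog.
pose hd := @cd_fst S m; pose re := @cd_snd_re S m; pose im := @cd_snd_im S m.
rewrite !mulnS muln0 addn0.
apply: prog_both; first exact: (prog_comp im hd (prog_dot_im prog m)).
apply: prog_both; first exact: (prog_comp hd im (prog_dot_im prog m)).
apply: prog_both; first exact: (prog_comp re im (prog_mapM_imr prog m)).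
apply: prog_both; first exact: (prog_comp im re (prog_mapM_iml prog m)).
apply: prog_both; first exact: (prog_comp hd re (prog_mapM_iml prog m)).
exact: (prog_comp re hd (prog_mapM_imr prog m)).
Qed.

Fact C_combine_is_linear m : linear (@C_combine m).
Proof.
move=> a [x1 [x2 [x3 [x4 [x5 [x6 [x7 x8]]]]]]].
move=> [y1 [y2 [y3 [y4 [y5 [y6 [y7 y8]]]]]]].
apply: injective_projections => /=; first by module_ring.
rewrite !(cd_scalarD, cd_scalarN, cd_scalarZ, cd_mapD, cd_mapN, cd_mapZ).
by module_ring.
Qed.

Fact R_combine_is_linear m : linear (@R_combine m).
Proof.
move=> a [x1 [x2 [x3 [x4 [x5 [x6 x7]]]]]] [y1 [y2 [y3 [y4 [y5 [y6 y7]]]]]].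
apply: injective_projections => /=.
  by rewrite cd_mapD cd_mapZ; module_ring.
rewrite !(cd_scalarD, cd_scalarN, cd_scalarZ, cd_mapD, cd_mapZ).
by module_ring.
Qed.

Lemma prog_C n : (0 < n)%N ->
  exists2 r, (r + 18 * 2 ^ n = 9 * n * 2 ^ n + 18)%N &
    bilinear_program r (@C_alg R Ro Ro Ro scal_mul n).
Proof.
elim: n => // m IH _; case: (posnP m) => [-> | m_gt0].
  by exists 0%N => //; apply: prog0.
have [r rE progC] := IH m_gt0.
exists (r + (r + 3 * (2 ^ m - 1) * 6))%N.
  by have := expn_gt0 2 m; rewrite expnS; nia.
have progp := prog_comp (@plus_iota Ro m) (@plus_iota Ro m) progC.
have progm := prog_comp (@minus_iota Ro m) (@minus_iota Ro m) progC.
have progs := prog_vector_operations m prog_cmul.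
have prog := prog_post (@C_combine_is_linear m)
  (prog_both progp (prog_both progm progs)).
by apply: prog_ext prog => -[u b] [v c]; apply: C_algE.
Qed.

Lemma prog_R n : (0 < n)%N ->
  exists2 r, (r + 21 * 2 ^ (n - 1) = 9 * n * 2 ^ (n - 1) + 12)%N &
    bilinear_program r (@R_alg R Ro Ro Ro scal_mul n).
Proof.
case: n => // m _; rewrite subn1 /=; case: (posnP m) => [-> | m_gt0].
  by exists 0%N => //; apply: prog0.
have [r rE progC] := prog_C m_gt0.
exists (r + 1 * (2 ^ m - 1) * 6)%N.
  by have := expn_gt0 2 m; rewrite /=; nia.
have progp := prog_comp (@real_plus_iota Ro m) (@real_plus_iota Ro m) progC.
have progs := prog_vector_operations m prog_rmul.
have prog := prog_post (@R_combine_is_linear m) (prog_both progp progs).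
by apply: prog_ext prog => -[u b] [v c]; apply: R_algE.
Qed.

Lemma prog_factors (U1 U2 T : vectType R) r (f : U1 -> U2 -> rec T) :
  bilinear_program r f ->
  exists (alpha : 'I_r -> {scalar U1}) (beta : 'I_r -> {scalar U2}),
    forall x y, (f x y).2 = [seq (alpha j x, beta j y) | j <- enum 'I_r].
Proof.
move=> [s <- fE]; pose p := tnth (in_tuple s).
exists (fun j => (p j).1.1), (fun j => (p j).1.2) => x y; rewrite fE /=.
transitivity [seq factors q x y | q <- map p (enum 'I_(size s))].
  by rewrite map_tnth_enum.
by rewrite -map_comp; apply: eq_map.
Qed.

(** * Tensor rank *)

Lemma prog_rank (U1 U2 T : vectType R) r (f : U1 -> U2 -> rec T) :
  bilinear_program r f -> rank_decomposition (fun x y => (f x y).1) r.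
Proof.
move=> [s <- fE]; pose p := tnth (in_tuple s).
exists (fun j => (p j).1.1), (fun j => (p j).1.2), (fun j => (p j).2) => x y.
by rewrite fE /= big_tnth.
Qed.

Lemma rank_cd_mul n : (0 < n)%N ->
  exists2 r, (r + 15 * 2 ^ (n - 1) = 9 * n * 2 ^ (n - 1) + 10)%N &
    rank_decomposition (@cd_mul R n) r.
Proof.
move=> n_gt0; have [r rE progR] := prog_R n_gt0.
pose f (x y : CDalg R n) := post
  (fun z : Ro * (CD Ro n * (CD Ro n * CD Ro n)) =>
     cd_scalar n z.1 + z.2.1 + z.2.2.1 + z.2.2.2)
  (both (dot rmul x (cd_conj y))
  (both (mapM_im (fun b => rmul (cd_re x) b) (cd_im y))
  (both (mapM_im (fun a => rmul a (cd_re y)) (cd_im x))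
        (R_alg scal_mul (cd_im x) (cd_im y))))).
have fE x y : cd_mul x y = (f x y).1.
  rewrite cd_mul_split /f /post /both; congr (_ + _ + _ + _).
  - by rewrite -dot_rmul.
  - by rewrite -mapM_im_rmull // cd_re_im.
  - by rewrite -mapM_im_rmulr // cd_re_im.
  - by rewrite -R_algP // cd_re_im.
pose k := (1 * 2 ^ n + (1 * (2 ^ n - 1) + (1 * (2 ^ n - 1) + r)))%N.
exists k.
  rewrite /k; case: n n_gt0 rE {k progR f fE} => // n _; rewrite subn1 /=.
  by have := expn_gt0 2 n; rewrite expnS; nia.
suff /prog_rank [alpha [beta [w E]]] : bilinear_program k f.
  by exists alpha, beta, w => x y; rewrite fE E.
apply: prog_post => [a x y|].
  by rewrite /= cd_scalarD cd_scalarZ; module_ring.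
pose id := idfun : {linear CD Ro n -> CD Ro n}.
pose re := @cd_re R Ro n; pose im := @cd_im R Ro n.
have rm := prog_rmul.
apply: prog_both; first exact: (prog_comp id (@cd_conj R n) (prog_dot rm n)).
apply: prog_both; first exact: (prog_comp re im (prog_mapM_imr rm n)).
apply: prog_both; first exact: (prog_comp im re (prog_mapM_iml rm n)).
exact: (prog_comp im im progR).
Qed.

Lemma tensor_rank_exists (U1 U2 W : vectType R) (mu : U1 -> U2 -> W) k :
  rank_decomposition mu k -> exists2 r, is_tensor_rank mu r & (r <= k)%N.
Proof.
move=> muk; have ex : exists r, `[< rank_decomposition mu r >].
  by exists k; apply/asboolP.
case: (ex_minnP ex) => r /asboolP mur rmin.
by exists r; [split=> // r' mur' |]; apply: rmin; apply/asboolP.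
Qed.

Lemma rank_bound_bigO :
  (fun n : nat => (9 * n%:R - 15) * 2 ^+ (n - 1) + 10 : R^o) =O_\oo
    (fun n : nat => 2 ^+ n * log2 (2 ^+ n) : R^o).
Proof.
have log2E n : log2 (2 ^+ n) = n%:R :> R.
  rewrite /log2 lnXn // -[X in X / _]mulr_natl mulfK // gt_eqF // ln_gt0 //.
  by rewrite ltr1n.
apply/eqOP; near=> k; near=> n; rewrite log2E.
have n_gt0 : (0 < n)%N by near: n; exists 1%N.
have n1 : 1 <= n%:R :> R by rewrite ler1n.
have p_ge1 : 1 <= 2 ^+ (n - 1) :> R by rewrite exprn_ege1 // ler1n.
have -> : 2 ^+ n = 2 * 2 ^+ (n - 1) :> R by rewrite -exprS subn1 prednK.
move: (2 ^+ (n - 1)) n%:R n1 p_ge1 => p x x1 p1.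
rewrite [in leRHS]ger0_norm; last by nra.
(* As p, x >= 1, the absolute value is at most 15 p x + 10 <= 50 p x. *)
apply: (@le_trans _ _ (25 * (2 * p * x))).
  by rewrite ler_norml; apply/andP; split; nra.
by rewrite ler_pM2r; [near: k; exact: nbhs_pinfty_ge | nra].
Unshelve. all: by end_near.
Qed.

End CrossProductAlgorithm.

Theorem theorem4p2 (R : realType) :
  (forall n : nat, (1 <= n)%N ->
     (forall X Y : CDalg R n, imaginary X -> imaginary Y ->
        R_output X Y = cross X Y) /\
     exists (r : nat) (alpha beta : 'I_r -> {scalar CDalg R n}),
       r%:R <= (9 * n%:R - 21) * 2 ^+ (n - 1) + 12 :> R /\
       forall X Y : CDalg R n, imaginary X -> imaginary Y ->
         R_products X Y = [seq (alpha j X, beta j Y) | j <- enum 'I_r]) /\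
  (forall n : nat, (1 <= n)%N ->
     exists r : nat, is_tensor_rank (@cd_mul R n) r /\
       r%:R <= (9 * n%:R - 15) * 2 ^+ (n - 1) + 10 :> R) /\
  (fun n : nat => (9 * n%:R - 15) * 2 ^+ (n - 1) + 10 : R^o) =O_\oo
    (fun n : nat => 2 ^+ n * log2 (2 ^+ n) : R^o).
Proof.
have bound (a b r n : nat) :
    (r + a * 2 ^ (n - 1) = 9 * n * 2 ^ (n - 1) + b)%N ->
    r%:R = (9 * n%:R - a%:R) * 2 ^+ (n - 1) + b%:R :> R.
  move=> /(congr1 (fun k : nat => k%:R : R)); rewrite !natrD !natrM natrX.
  by move=> E; rewrite mulrBl addrAC -E addrK.
split; [move=> n n_gt0; split | split; [move=> n n_gt0|]].
- move=> X Y /imaginaryE X0 /imaginaryE Y0; exact: R_algP.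
- have [r rE /prog_factors [alpha [beta E]]] := prog_R R n_gt0.
  exists r, alpha, beta; split; first by rewrite (bound _ _ _ _ rE).
  by move=> X Y _ _; apply: E.
- have [k kE /tensor_rank_exists [r rankr rk]] := rank_cd_mul R n_gt0.
  exists r; split=> //; rewrite -(bound _ _ _ _ kE).
  by rewrite ler_nat.
- exact: rank_bound_bigO.
Qed.
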